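(* Let $M$ be a locally compact positive definite metric space. Suppose that the magnitude $\mathrm{mag}\colon \mathrm{Cmp}_+(M)\rightharpoonup\mathbb{R}$ is defined (i.e. finite) and continuous at some $K\in\mathrm{Cmp}_+(M)$. Then there exists a tractable neighborhood $T\subseteq M$ of $K$ (in particular, the restriction of $\mathrm{mag}$ to $\mathrm{Cmp}_+(T)$ is a total map $\mathrm{Cmp}_+(T)\to\mathbb{R}$).
   Context: For a finite metric space $F=\{a_1,\dots,a_n\}$ (distinct points) with metric $d$, its similarity matrix is $Z_F\in\mathbb{R}^{n\times n}$ with $(Z_F)_{ij}=e^{-d(a_i,a_j)}$. A metric space is positive definite if every finite subspace has a positive definite similarity matrix. For a finite positive definite space $F$, its magnitude $\mathrm{mag}(F)$ is the sum of all entries of $Z_F^{-1}$ (so $\mathrm{mag}(\emptyset)=0$). For a compact positive definite space $K$, $\mathrm{mag}(K):=\sup\{\mathrm{mag}(F) : F\subseteq K \text{ finite}\}\in[0,\infty]$; this agrees with the previous definition when $K$ is finite. $\mathrm{Cmp}_+(M)$ is the set of non-empty compact subsets of $M$ with the Hausdorff metric $d_H$. The symbol $\rightharpoonup$ denotes a partial map: $\mathrm{mag}\colon \mathrm{Cmp}_+(M)\rightharpoonup\mathbb{R}$ is defined at those $L$ with $\mathrm{mag}(L)<\infty$, and continuity at a point $K$ of the domain is continuity on the domain with its subspace topology. A metric space $T$ is tractable if it is positive definite and, for every $x\in T$ and real $r>0$, the closed ball in $T$ with center $x$ and radius $r$ is compact and has finite magnitude. A neighborhood of $K$ in $M$ is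 a subset of $M$ whose interior contains $K$; it carries the restricted metric. *)

(* Defs.v *)
From HB Require Import structures.
From mathcomp Require Import all_boot all_order all_algebra finmap.
From mathcomp Require Import all_classical all_reals all_analysis.

Set Implicit Arguments.
Unset Strict Implicit.
Unset Printing Implicit Defensive.

Import Order.TTheory GRing.Theory Num.Theory.
Import numFieldNormedType.Exports.

Local Open Scope classical_set_scope.
Local Open Scope ring_scope.

Section restricted_metric.
Context {R : realType} {M : metricType R} (A : set M).

Let sdist (x y : set_type A) : R := mdist (set_val x) (set_val y).

Let sdist_ge0 x y : 0 <= sdist x y.
Proof. exact: mdist_ge0. Qed.

Let sdist_positivity x y : sdist x y = 0 -> x = y.
Proof. by move=> /mdist_positivity; exact: val_inj. Qed.

Let ballEsdist x d : ball x d = [set y | sdist x y < d].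
Proof. by rewrite -(@initial_ballE R) ballEmdist. Qed.

HB.instance Definition _ := @PseudoMetric_isMetric.Build R (set_type A)
  sdist sdist_ge0 sdist_positivity ballEsdist.

End restricted_metric.

Section hausdorff_metric.
Context {R : realType} {M : metricType R}.

(* [inf] and [sup] of reals default to 0 on empty or unbounded sets; on
   non-empty compact sets neither case occurs, see [infdist_has_inf] and
   [infdist_has_sup]. *)
Definition infdist (x : M) (A : set M) : R := inf [set mdist x a | a in A].

Definition hausdorff_dist (A B : set M) : R :=
  Num.max (sup [set infdist a B | a in A]) (sup [set infdist b A | b in B]).

End hausdorff_metric.

Record Cmp {R : realType} (M : metricType R) := MkCmp {
  Cmp_set :> set M ;
  Cmp_neq0 : Cmp_set !=set0 ;
  Cmp_compact : compact Cmp_set }.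

HB.instance Definition _ {R : realType} (M : metricType R) :=
  gen_eqMixin (Cmp M).
HB.instance Definition _ {R : realType} (M : metricType R) :=
  gen_choiceMixin (Cmp M).

Section hausdorff_metric_theory.
Context {R : realType} {M : metricType R}.
Implicit Types (A B C : Cmp M) (x y : M).

Lemma Cmp_inj A B : A = B :> set M -> A = B.
Proof.
case: A B => [A A0 cA] [B B0 cB] /= AB; case: _ / AB in B0 cB *.
by rewrite (Prop_irrelevance A0 B0) (Prop_irrelevance cA cB).
Qed.

Lemma infdist_has_inf x A : has_inf [set mdist x a | a in (A : set M)].
Proof.
split; first by have [a Aa] := Cmp_neq0 A; exists (mdist x a), a.
by exists 0 => _ [a _ <-]; exact: mdist_ge0.
Qed.

Lemma infdist_ge0 x A : 0 <= infdist x A.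
Proof.
apply: lb_le_inf; first by case: (infdist_has_inf x A).
by move=> _ [a _ <-]; exact: mdist_ge0.
Qed.

Lemma infdist_le x A y : (A : set M) y -> infdist x A <= mdist x y.
Proof.
by move=> Ay; apply: ge_inf; [case: (infdist_has_inf x A)|exists y].
Qed.

Lemma infdist_lt x A (e : R) : 0 < e ->
  exists2 y, (A : set M) y & mdist x y < infdist x A + e.
Proof.
by move=> /inf_adherent/(_ (infdist_has_inf x A)) [_ [y Ay <-] ?]; exists y.
Qed.

Lemma infdist_bounded A B :
  exists r : R, forall a, (A : set M) a -> infdist a B <= r.
Proof.
have [b Bb] := Cmp_neq0 B.
have /compact_near_coveringP := @Cmp_compact _ _ A.
move=> /(_ R (pinfty_nbhs R) (fun r a => mdist a b <= r) _) cov.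
have [] := cov.
  move=> x Ax; exists (ball x 1, [set r | mdist x b + 1 < r]) => /=.
    by split; [exact: nbhsx_ballx|exists (mdist x b + 1); split => //; exact: num_real].
  move=> [y r] /= [xy xr]; rewrite (le_trans (metric_triangle y x b))// ltW//.
  rewrite (le_lt_trans _ xr)// addrC lerD2l ltW// metric_sym.
  by move: xy; rewrite ballEmdist.
move=> r [_ rP]; exists (r + 1) => a Aa.
by rewrite (le_trans (infdist_le a Bb))//; apply: rP => //; rewrite ltrDl.
Qed.

Lemma infdist_has_sup A B : has_sup [set infdist a B | a in (A : set M)].
Proof.
split; first by have [a Aa] := Cmp_neq0 A; exists (infdist a B), a.
by have [r rP] := infdist_bounded A B; exists r => _ [a Aa <-]; exact: rP.
Qed.

Lemma hausdorff_distC A B : hausdorff_dist A B = hausdorff_dist B A.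
Proof. by rewrite /hausdorff_dist maxC. Qed.

Lemma infdist_le_hausdorff A B x :
  (A : set M) x -> infdist x B <= hausdorff_dist A B.
Proof.
move=> Ax; rewrite le_max; apply/orP; left; apply: ub_le_sup; last by exists x.
by case: (infdist_has_sup A B).
Qed.

Lemma hausdorff_dist_le A B (r : R) :
  (forall x, (A : set M) x -> infdist x B <= r) ->
  (forall x, (B : set M) x -> infdist x A <= r) ->
  hausdorff_dist A B <= r.
Proof.
move=> AB BA; rewrite ge_max; apply/andP; split; apply: ge_sup.
- by case: (infdist_has_sup A B).
- by move=> _ [a Aa <-]; exact: AB.
- by case: (infdist_has_sup B A).
- by move=> _ [a Aa <-]; exact: BA.
Qed.

Lemma hausdorff_distxx A : hausdorff_dist A A = 0.
Proof.
have h x : (A : set M) x -> infdist x A <= 0.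
  by move=> Ax; rewrite (le_trans (infdist_le x Ax))// mdistxx.
apply/eqP; rewrite eq_le hausdorff_dist_le//=.
have [a Aa] := Cmp_neq0 A.
exact: le_trans (infdist_ge0 a A) (infdist_le_hausdorff _ Aa).
Qed.

Lemma hausdorff_dist_sub A B :
  hausdorff_dist A B = 0 -> (A : set M) `<=` (B : set M).
Proof.
move=> AB0 a Aa.
have clB : closed (B : set M).
  exact: compact_closed (@metric_hausdorff _ _) (@Cmp_compact _ _ B).
apply: clB => U /nbhs_ballP[e /= e0 eU].
have [b Bb ab] := infdist_lt a B e0; exists b; split => //; apply: eU.
rewrite ballEmdist /= (lt_le_trans ab)// gerDr -AB0.
exact: infdist_le_hausdorff.
Qed.

Lemma hausdorff_dist_positivity A B : hausdorff_dist A B = 0 -> A = B.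
Proof.
move=> AB; apply: Cmp_inj; apply/seteqP; split.
  exact: hausdorff_dist_sub.
by apply: hausdorff_dist_sub; rewrite hausdorff_distC.
Qed.

Lemma infdist_triangle A B C x : (A : set M) x ->
  infdist x C <= hausdorff_dist A B + hausdorff_dist B C.
Proof.
move=> Ax; apply/ler_addgt0Pr => e e0; have e2 : 0 < e / 2 by rewrite divr_gt0.
have [b Bb xb] := infdist_lt x B e2; have [c Cc bc] := infdist_lt b C e2.
rewrite (le_trans (infdist_le x Cc))// (le_trans (metric_triangle x b c))//.
rewrite [e]splitr addrACA lerD//.
  by rewrite (le_trans (ltW xb))// lerD2r infdist_le_hausdorff.
by rewrite (le_trans (ltW bc))// lerD2r infdist_le_hausdorff.
Qed.

Lemma hausdorff_dist_triangle B A C :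
  hausdorff_dist A C <= hausdorff_dist A B + hausdorff_dist B C.
Proof.
apply: hausdorff_dist_le => x; first exact: infdist_triangle.
by move=> /(@infdist_triangle C B A); rewrite addrC !(hausdorff_distC B).
Qed.

End hausdorff_metric_theory.

HB.instance Definition _ {R : realType} (M : metricType R) :=
  @isMetric.Build R (Cmp M) (fun A B => hausdorff_dist A B)
    hausdorff_distxx hausdorff_dist_positivity
    hausdorff_distC hausdorff_dist_triangle.

Section magnitude.
Context {R : realType}.

Definition posdefmx n (A : 'M[R]_n) :=
  A^T = A /\ forall v : 'cV[R]_n, v != 0 -> 0 < (v^T *m A *m v) 0 0.

(* The enumeration of a finite set [F] used below lists each point once; both
   [posdefmx] and the sum of the entries of the inverse are insensitive to the
   order of the points. *)
Definition simmx (M : metricType R) (F : {fset M}) : 'M[R]_(#|` F|) :=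
  \matrix_(i, j) expR (- mdist (tnth (in_tuple F) i) (tnth (in_tuple F) j)).

Definition posdef_space (M : metricType R) :=
  forall F : {fset M}, posdefmx (simmx F).

Definition fin_mag (M : metricType R) (F : {fset M}) : R :=
  \sum_i \sum_j invmx (simmx F) i j.

Definition mag (M : metricType R) (K : set M) : \bar R :=
  ereal_sup [set (fin_mag F)%:E | F in [set F : {fset M} | [set` F] `<=` K]].

Definition mag_dom (M : metricType R) : set (Cmp M) :=
  [set L : Cmp M | (mag L < +oo)%E].

(* On [mag_dom M] the magnitude is a real number ([fset0] bounds it below by
   0), so [fine] does not alter it there; the filter
   [within (mag_dom M) (nbhs K)] is that of the subspace topology on
   [mag_dom M]. *)
Definition mag_continuous_at (M : metricType R) (K : Cmp M) :=
  (fun L : Cmp M => fine (mag L)) @ within (@mag_dom M) (nbhs K)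
    --> fine (mag K).

(* [closed_ball] of the library is the closure of the open ball, which may be
   strictly smaller in a general metric space. *)
Definition mcball (M : metricType R) (x : M) (r : R) : set M :=
  [set y | mdist x y <= r].

Definition tractable (T : metricType R) :=
  posdef_space T /\
  forall (x : T) (r : R), 0 < r ->
    compact (mcball x r) /\ (mag (mcball x r) < +oo)%E.

End magnitude.

(* Main.v *)
Require Import Defs.
From mathcomp Require Import all_boot all_order all_algebra finmap.
From mathcomp Require Import all_classical all_reals all_analysis.

Set Implicit Arguments.
Unset Strict Implicit.
Unset Printing Implicit Defensive.

Import Order.TTheory GRing.Theory Num.Theory.
Import numFieldNormedType.Exports.

Local Open Scope classical_set_scope.
Local Open Scope ring_scope.

(** A single bound does everything: on some closed thickening of [K] of radius
    [e], every finite subset [F] has magnitude at most [mag K + 1].  To see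
    this, add to [F] a finite [e]-net [N] of [K].  The finite set [F `|` N] is
    within Hausdorff distance [e] of [K], and it lies in the domain of the
    magnitude because a finite set has only finitely many subsets; so
    continuity at [K] bounds the magnitude of [F `|` N], and that magnitude, a
    supremum over subsets, dominates the one of [F]
    ([fin_mag_thickening_bounded]).

    By local compactness [K] has a compact neighborhood [T] inside that
    thickening ([compact_thickening]), and then [mag T <= mag K + 1].  All the
    subsets of [T] have finite magnitude, and the closed balls of [T] are
    closed in a compact space, hence compact, which makes [T] tractable.

    Two things have to be transported to the type [set_type T] along its
    isometric inclusion in [M]: positive definiteness and magnitude.  An
    isometry may list the points of a finite set in another order, so the
    similarity matrices agree only up to a simultaneous reindexing of rows and
    columns ([simmx_isometry]), which neither notion sees. *)

(** * Reindexing positive definite matrices *)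

Section matrices.
Context {R : realType}.

Lemma posdefmx_unit n (A : 'M[R]_n) : posdefmx A -> A \in unitmx.
Proof.
move=> [_ Apos]; rewrite unitmxE unitfE; apply/negP => /det0P[v v0 vA].
have := Apos v^T; rewrite trmxK vA mul0mx mxE ltxx trmx_eq0 => /(_ v0).
done.
Qed.

Lemma mxsub_congruence n m (s t : 'I_n -> 'I_m) (A : 'M[R]_m) :
  mxsub s t A = rowsub s 1%:M *m A *m (rowsub t 1%:M)^T.
Proof.
rewrite -rowsubE trmx_mxsub trmx1 mulmx_colsub mulmx1.
by apply/matrixP => i j; rewrite !mxE.
Qed.

(** For injective [s] the matrix [S := rowsub s 1%:M] has orthonormal rows, so
    [S^T] is an injective linear map: this is what carries positivity to
    principal submatrices. *)
Lemma rowsub1_orthonormal n m (s : 'I_n -> 'I_m) :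
  injective s -> rowsub s 1%:M *m (rowsub s (1%:M : 'M[R]_m))^T = 1%:M.
Proof.
move=> sinj; rewrite -[X in X *m _]mulmx1 -mxsub_congruence.
by apply/matrixP => i j; rewrite !mxE (inj_eq sinj).
Qed.

Lemma posdefmx_mxsub n m (s : 'I_n -> 'I_m) (A : 'M[R]_m) :
  injective s -> posdefmx A -> posdefmx (mxsub s s A).
Proof.
move=> sinj [Asym Apos]; split; first by rewrite trmx_mxsub Asym.
move=> v v0; rewrite mxsub_congruence; set S := rowsub s 1%:M.
have -> : v^T *m (S *m A *m S^T) *m v = (S^T *m v)^T *m A *m (S^T *m v).
  by rewrite trmx_mul trmxK !mulmxA.
apply: Apos; apply: contraNN v0 => /eqP Sv0.
by rewrite -[v]mul1mx -(rowsub1_orthonormal sinj) -mulmxA Sv0 mulmx0.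
Qed.

Lemma invmx_mxsub n m (s : 'I_n -> 'I_m) (A : 'M[R]_m) :
  bijective s -> A \in unitmx -> invmx (mxsub s s A) = mxsub s s (invmx A).
Proof.
move=> sbij Au.
have AA' : mxsub s s A *m mxsub s s (invmx A) = 1%:M.
  apply/matrixP => i j; transitivity ((A *m invmx A) (s i) (s j)).
    rewrite !mxE (reindex s (onW_bij _ sbij))/=.
    by apply: eq_bigr => k _; rewrite !mxE.
  by rewrite mulmxV// !mxE (inj_eq (bij_inj sbij)).
have [Su _] := mulmx1_unit AA'.
by rewrite -[RHS](mulKmx Su) AA' mulmx1.
Qed.

End matrices.

(** * Compact sets *)

(** The finite subcover property, phrased as an induction principle.  If [P A]
    failed, the complements in [A] of the sets satisfying [P] would generate a
    proper filter on [A], and no point of [A] having a neighborhood that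
    satisfies [P] could be a cluster point of it. *)
Lemma compact_ind (X : topologicalType) (A : set X) (P : set X -> Prop) :
  compact A -> P set0 ->
  (forall B C, B `<=` C -> P C -> P B) ->
  (forall B C, P B -> P C -> P (B `|` C)) ->
  (forall x, A x -> exists2 U, nbhs x U & P U) ->
  P A.
Proof.
move=> Acpt P0 Psub PU Ploc; apply: contrapT => nPA.
pose F := [set B | exists2 C, P C & A `\` C `<=` B].
have FF : ProperFilter F.
  split.
    by move=> [C PC]; rewrite subset0 setD_eq0 => AC; apply/nPA/(Psub _ C).
  split.
  - by exists set0.
  - move=> B1 B2 [C1 PC1 B1C] [C2 PC2 B2C]; exists (C1 `|` C2); first exact: PU.
    move=> x [Ax /not_orP[C1x C2x]]; split; [exact: B1C|exact: B2C].
  - by move=> B1 B2 B12 [C PC CB]; exists C => //; exact: subset_trans B12.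
have FA : F A by exists set0 => // x [].
have [x [Ax clx]] := Acpt F FF FA; have [U xU PU'] := Ploc x Ax.
have [|y [[_ nUy] Uy]//] := clx (A `\` U) U _ xU.
by exists U.
Qed.

Lemma compact_set_type (X : topologicalType) (A : set X) :
  compact A -> compact [set: set_type A].
Proof.
move=> Acpt F FF _.
have GA : ((set_val : set_type A -> X) @ F) A.
  by apply: (@filterS _ F _ setT) => [x _|]; [exact: set_valP|exact: filterT].
have [x [Ax clx]] := Acpt _ _ GA.
exists (SigSub (mem_set Ax)); split => // B V FB [_ [[W Wop <-] /= Wx WV]].
have FvB : ((set_val : set_type A -> X) @ F) (set_val @` B).
  by apply: (@filterS _ F _ B) => // y By; exists y.
have [_ [[y By <-] Wy]] := clx _ W FvB (open_nbhs_nbhs (conj Wop Wx)).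
by exists y; split => //; exact: WV.
Qed.

Section metric_compactness.
Context {R : realType}.
Implicit Types (M : metricType R).

Lemma closed_mcball M (x : M) (r : R) : closed (mcball x r).
Proof.
move=> y yc; rewrite /mcball /=; apply/ler_addgt0Pr => e e0.
have [z [/= xz]] := yc _ (nbhsx_ballx y e e0).
rewrite ballEmdist /= => yz; rewrite (le_trans (metric_triangle x z y))//.
by rewrite lerD// metric_sym ltW.
Qed.

Lemma compact_net M (K : set M) (e : R) : compact K -> 0 < e ->
  exists2 N : {fset M}, [set` N] `<=` K &
    forall x, K x -> exists2 y, y \in N & mdist x y <= e.
Proof.
move=> Kcpt e0; pose P S := exists2 N : {fset M}, [set` N] `<=` K &
    forall x, S x -> exists2 y, y \in N & mdist x y <= e.
apply: (@compact_ind M K P) => //.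
- by exists fset0.
- by move=> B C BC [N NK CN]; exists N => // x /BC/CN.
- move=> B C [N NK BN] [N' N'K CN']; exists (N `|` N')%fset => [x /=|x].
    by rewrite in_fsetU => /orP[/NK|/N'K].
  by move=> [/BN|/CN'] [y yN xy]; exists y => //; rewrite in_fsetU yN ?orbT.
move=> x Kx; exists (ball x e); first exact: nbhsx_ballx.
exists [fset x]%fset => [y /=|y]; first by rewrite in_fset1 => /eqP ->.
by rewrite ballEmdist /= => xy; exists x; rewrite ?in_fset1// metric_sym ltW.
Qed.

(** Around each point of [K] intersect a compact neighborhood with a small
    closed ball; finitely many of these cover [K].  Bounding the distance of
    each piece to its own centre avoids the Lebesgue number of the cover. *)
Lemma compact_thickening M (K : set M) (e : R) :
  locally_compact [set: M] -> compact K -> 0 < e ->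
  exists T : set M, [/\ compact T, K `<=` T° &
    forall x, T x -> exists2 y, K y & mdist x y <= e].
Proof.
move=> Mlc Kcpt e0; pose P S := exists T : set M, [/\ compact T, S `<=` T° &
    forall x, T x -> exists2 y, K y & mdist x y <= e].
apply: (@compact_ind M K P) => //.
- by exists set0; split => //; exact: compact0.
- by move=> B C BC [T [? CT ?]]; exists T; split => //; exact: subset_trans CT.
- move=> B C [T [Tcpt BT TK]] [T' [T'cpt CT' T'K]]; exists (T `|` T'); split.
  + exact: compactU.
  + by move=> x [/BT|/CT']; apply: interiorS => y; [left|right].
  + by move=> x [/TK|/T'K].
move=> x Kx; have := Mlc x I; rewrite withinET => -[C xC [Ccpt _]].
exists (C `&` mcball x e)°; last first.
  exists (C `&` mcball x e); split => //.
    by apply: compact_closedI => //; exact: closed_mcball.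
  by move=> y [_ xy]; exists x => //; rewrite metric_sym.
apply: nbhs_interior; apply: filterI => //.
apply: filterS (nbhsx_ballx x e e0) => y; rewrite ballEmdist /=.
exact: ltW.
Qed.

End metric_compactness.

(** * Magnitude *)

Section magnitude_bounds.
Context {R : realType}.
Implicit Types (M : metricType R).

Lemma simmx_isometry M M' (f : M -> M') (F : {fset M}) :
  (forall x y, mdist (f x) (f y) = mdist x y) ->
  exists2 s : 'I_(#|` F|) -> 'I_(#|` (f @` F)%fset|),
    bijective s & simmx F = mxsub s s (simmx (f @` F)%fset).
Proof.
move=> fiso.
have finj : injective f.
  by move=> x y fxy; apply: mdist_positivity; rewrite -fiso fxy mdistxx.
set G := (f @` F)%fset.
have memG i : (index (f (tnth (in_tuple F) i)) G < #|` G|)%N.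
  by rewrite index_mem; apply: in_imfset; exact: mem_tnth.
pose s i := Ordinal (memG i).
have sE i : tnth (in_tuple G) (s i) = f (tnth (in_tuple F) i).
  by rewrite (tnth_nth (f (tnth (in_tuple F) i))) nth_index// -index_mem.
exists s.
  apply: inj_card_bij.
    move=> i j /(congr1 (tnth (in_tuple G))); rewrite !sE => /finj.
    by have /tuple_uniqP/(_ i j) := fset_uniq F : uniq (in_tuple F).
  by rewrite !card_ord card_imfset.
by apply/matrixP => i j; rewrite !mxE !sE fiso.
Qed.

Lemma posdef_space_isometry M M' (f : M -> M') :
  (forall x y, mdist (f x) (f y) = mdist x y) ->
  posdef_space M' -> posdef_space M.
Proof.
move=> fiso M'pd F; have [s /bij_inj sinj ->] := simmx_isometry F fiso.
exact: posdefmx_mxsub.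
Qed.

Lemma fin_mag_isometry M M' (f : M -> M') (F : {fset M}) :
  (forall x y, mdist (f x) (f y) = mdist x y) -> posdef_space M' ->
  fin_mag F = fin_mag (f @` F)%fset.
Proof.
move=> fiso M'pd; have [s sbij FE] := simmx_isometry F fiso.
rewrite /fin_mag FE invmx_mxsub//; last exact/posdefmx_unit/M'pd.
rewrite [RHS](reindex s (onW_bij _ sbij))/=; apply: eq_bigr => i _.
rewrite [RHS](reindex s (onW_bij _ sbij))/=.
by apply: eq_bigr => j _; rewrite mxE.
Qed.

Lemma fin_mag_le_mag M (A : set M) (F : {fset M}) :
  [set` F] `<=` A -> ((fin_mag F)%:E <= mag A)%E.
Proof. by move=> FA; apply: ereal_sup_ubound; exists F. Qed.

Lemma mag_le M (A : set M) (r : \bar R) :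
  (forall F : {fset M}, [set` F] `<=` A -> ((fin_mag F)%:E <= r)%E) ->
  (mag A <= r)%E.
Proof. by move=> Ar; apply: ge_ereal_sup => _ [F FA <-]; exact: Ar. Qed.

Lemma mag_isometry_le M M' (f : M -> M') (A : set M) (B : set M') :
  (forall x y, mdist (f x) (f y) = mdist x y) -> posdef_space M' ->
  f @` A `<=` B -> (mag A <= mag B)%E.
Proof.
move=> fiso M'pd AB; apply: mag_le => F FA.
rewrite (fin_mag_isometry F fiso M'pd); apply: fin_mag_le_mag.
by move=> _ /= /imfsetP[x /= xF ->]; apply: AB; exists x => //; exact: FA.
Qed.

(** A crude bound suffices: the sum of the [`|fin_mag G|] over the finitely many
    subsets [G] of [F]. *)
Lemma mag_fset_lty M (F : {fset M}) : (mag [set` F] < +oo)%E.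
Proof.
apply: (@le_lt_trans _ _ (\sum_(G <- fpowerset F) `|fin_mag G|)%:E); last first.
  exact: ltry.
apply: mag_le => G GF; rewrite lee_fin.
have GpF : G \in fpowerset F by rewrite fpowersetE; apply/fsubsetP.
rewrite (big_rem G)//= (le_trans (ler_norm _))// lerDl.
by apply: sumr_ge0 => ? _; exact: normr_ge0.
Qed.

(** Continuity is used here only, as local boundedness on the domain.  The bound
    is stated for the finite subsets of [L] because those are what the supremum
    defining [mag T] runs through. *)
Lemma fin_mag_hausdorff_bounded M (K : Cmp M) : mag_continuous_at K ->
  exists2 e : R, 0 < e & forall (L : Cmp M) (F : {fset M}),
    hausdorff_dist K L < e -> mag_dom L -> [set` F] `<=` L ->
    fin_mag F <= fine (mag K) + 1.
Proof.
move=> /cvgr_dist_lt/(_ _ ltr01); rewrite /within /= => /nbhs_ballP[e /= e0 eK].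
exists e => // L F KL Ldom FL.
have := eK L; rewrite ballEmdist => /(_ KL Ldom).
rewrite ltr_distlC => /andP[_ /ltW]; apply: le_trans.
rewrite -lee_fin fineK; first exact: fin_mag_le_mag.
rewrite fin_real// Ldom andbT.
by rewrite (lt_le_trans _ (fin_mag_le_mag FL))// ltNyr.
Qed.

(** The points of [F] may all sit near one corner of [K], far from [K] in the
    Hausdorff sense; a finite net of [K] repairs this while keeping the set
    finite, hence in the domain of the magnitude. *)
Lemma fin_mag_thickening_bounded M (K : Cmp M) : mag_continuous_at K ->
  exists2 e : R, 0 < e & forall F : {fset M},
    (forall x, x \in F -> exists2 y, (K : set M) y & mdist x y <= e) ->
    fin_mag F <= fine (mag K) + 1.
Proof.
move=> /fin_mag_hausdorff_bounded[e e0 eK].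
have e2 : 0 < e / 2 by rewrite divr_gt0.
exists (e / 2) => // F FK.
have [N NK KN] := compact_net (@Cmp_compact _ _ K) e2.
have FN0 : [set` (F `|` N)%fset] !=set0.
  have [x /KN[y yN _]] := Cmp_neq0 K.
  by exists y; rewrite /= in_fsetU yN orbT.
pose L := MkCmp FN0 (finite_compact (finite_fset (F `|` N)%fset)).
apply: (eK L).
- rewrite (@le_lt_trans _ _ (e / 2))// ?ltr_pdivrMr ?ltr_pMr ?ltr1n//.
  apply: hausdorff_dist_le => x.
    move=> /KN[y yN xy]; apply: le_trans xy; apply: infdist_le => /=.
    by rewrite in_fsetU yN orbT.
  rewrite /= in_fsetU => /orP[/FK[y Ky xy]|/NK Kx].
    by apply: le_trans xy; exact: infdist_le.
  by rewrite (le_trans (infdist_le x Kx))// mdistxx ltW.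
- exact: mag_fset_lty.
- by move=> x /= xF; rewrite in_fsetU xF.
Qed.

End magnitude_bounds.

(** * The tractable neighborhood *)

Theorem proposition3p8 (R : realType) (M : metricType R)
    (Mlc : locally_compact [set: M]) (Mpd : posdef_space M)
    (K : Cmp M) (Kdom : mag_dom K) (Kcont : mag_continuous_at K) :
  exists T : set M,
    [/\ (K : set M) `<=` T°,
        tractable (set_type T) &
        forall L : Cmp (set_type T), mag_dom L].
Proof.
have [e e0 eK] := fin_mag_thickening_bounded Kcont.
have [T [Tcpt KT TK]] := compact_thickening Mlc (@Cmp_compact _ _ K) e0.
have magT : (mag T < +oo)%E.
  apply: (@le_lt_trans _ _ (fine (mag K) + 1)%:E); last exact: ltry.
  by apply: mag_le => F FT; rewrite lee_fin; apply: eK => x /FT/TK.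
have Viso (x y : set_type T) : mdist (set_val x) (set_val y) = mdist x y by [].
have magsub (A : set (set_type T)) : (mag A < +oo)%E.
  apply: le_lt_trans magT; apply: (mag_isometry_le Viso Mpd).
  by move=> _ [x _ <-]; exact: (set_valP x).
exists T; split => //; last by move=> L; exact: magsub.
split; first exact: posdef_space_isometry Viso Mpd.
move=> x r r0; split => //.
apply: subclosed_compact (compact_set_type Tcpt) _ => //.
exact: closed_mcball.
Qed.
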